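(* Let $p,q$ be non-zero complex numbers with $pq\neq\pm1$. If $T=\begin{pmatrix} a&\beta\\ \gamma&d\end{pmatrix}\in GL_{p,q}(1|1)$ and $n$ is a positive integer, then $T^n\in GL_{p^n,q^n}(1|1)$. That is, writing $T^n=\begin{pmatrix} A_n&B_n\\ C_n&D_n\end{pmatrix}$, the entries satisfy $$A_nB_n=q^nB_nA_n,\qquad D_nB_n=q^nB_nD_n,$$ $$A_nC_n=p^nC_nA_n,\qquad D_nC_n=p^nC_nD_n,$$ $$B_n^2=0=C_n^2,\qquad q^nB_nC_n+p^nC_nB_n=0,$$ $$A_nD_n-D_nA_n=(p^n-q^{-n})\,C_nB_n .$$
   Context: Setting: $a,\beta,\gamma,d$ are elements of a unital associative $\mathbb{C}$-algebra. The matrix $T=\begin{pmatrix} a&\beta\\ \gamma&d\end{pmatrix}$ is said to belong to $GL_{p,q}(1|1)$ if $a\beta=q\beta a$, $d\beta=q\beta d$, $a\gamma=p\gamma a$, $d\gamma=p\gamma d$, $\beta\gamma+pq^{-1}\gamma\beta=0$, $\beta^2=0=\gamma^2$, $ad-da=(p-q^{-1})\gamma\beta$. It is a standing assumption that $a$ and $d$ are invertible. $T^n$ is the $n$-th power under the ordinary matrix product (non-commuting entries multiplied in order). Membership of $T^n$ in $GL_{p^n,q^n}(1|1)$ means exactly that the displayed relations in the claim hold. *)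

(* Defs.v *)
From HB Require Import structures.
From mathcomp Require Import all_boot all_order all_algebra.
From mathcomp Require Import reals complex.
Set Implicit Arguments.
Unset Strict Implicit.
Unset Printing Implicit Defensive.
Import GRing.Theory.
Local Open Scope ring_scope.

(* [algType] comes without units, so invertibility is stated by a two-sided
   inverse; this avoids requiring a decidable set of units on the algebra. *)
Definition invertible (A : nzRingType) (x : A) : Prop :=
  exists y : A, y * x = 1 /\ x * y = 1.

Record GL11_relations (K : fieldType) (A : algType K) (p q : K)
    (a beta gamma d : A) : Prop := {
  GL11_abeta : a * beta = q *: (beta * a);
  GL11_dbeta : d * beta = q *: (beta * d);
  GL11_agamma : a * gamma = p *: (gamma * a);
  GL11_dgamma : d * gamma = p *: (gamma * d);
  GL11_betagamma : beta * gamma + (p * q^-1) *: (gamma * beta) = 0;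
  GL11_beta2 : beta ^+ 2 = 0;
  GL11_gamma2 : gamma ^+ 2 = 0;
  GL11_ad : a * d - d * a = (p - q^-1) *: (gamma * beta)
}.

(* Invertibility of the diagonal entries is deliberately not part of this
   predicate: it is a separate assumption on the initial matrix. *)
Definition in_GL11 (K : fieldType) (A : algType K) (p q : K) (T : 'M[A]_2)
    : Prop :=
  GL11_relations p q (T 0 0) (T 0 1) (T 1 0) (T 1 1).

(* Main.v *)
Require Import Defs.
From HB Require Import structures.
From mathcomp Require Import all_boot all_order all_algebra.
From mathcomp Require Import reals complex.
From mathcomp Require Import ring.
Set Implicit Arguments.
Unset Strict Implicit.
Unset Printing Implicit Defensive.
Import GRing.Theory.
Local Open Scope ring_scope.

(** The products [beta * gamma] and [gamma * beta] are proportional, and every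
    product with three odd factors vanishes. Hence, with n = m + 1,
      T^n = [[a^n + beta gamma x, beta b], [gamma c, d^n + gamma beta y]]
    where b, c, x, y are polynomials in a and d. The elements a and d commute
    after left multiplication by beta or gamma, so all relations except the last
    are immediate. With z = gamma beta and r = p q, the last one follows from
      [a^n, d^n] = (p - q^-1) [n]_r^2 z a^m d^m
    and the identity, valid after left multiplication by z,
      c b = [n]_r a^m d^m + q a^n y + p d^n x,
    which is proved by induction on m. *)

Lemma mxE2 (S : nzRingType) (M N : 'M[S]_2) (i j : 'I_2) :
  (M * N) i j = M i 0 * N 0 j + M i 1 * N 1 j.
Proof.
rewrite mxE big_ord_recl big_ord1.
by have -> : lift ord0 ord0 = 1 :> 'I_2 by apply: val_inj.
Qed.

(** * Quasi-commutation, and commutation after left multiplication *)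

Section QuasiCommutation.
Variables (K : fieldType) (A : algType K).
Implicit Types (s t k : K) (a d v w x y : A).

Definition qcomm s x v := x * v = s *: (v * x).

Lemma qcomm1 v : qcomm 1 1 v.
Proof. by rewrite /qcomm mul1r mulr1 scale1r. Qed.

Lemma qcommD s x y v : qcomm s x v -> qcomm s y v -> qcomm s (x + y) v.
Proof. by rewrite /qcomm mulrDl mulrDr scalerDr => -> ->. Qed.

Lemma qcommZ s k x v : qcomm s x v -> qcomm s (k *: x) v.
Proof. by rewrite /qcomm -scalerAl -scalerAr => ->; rewrite !scalerA mulrC. Qed.

Lemma qcommMl s t x y v : qcomm s x v -> qcomm t y v -> qcomm (s * t) (x * y) v.
Proof.
by move=> xv yv; rewrite /qcomm -mulrA yv -scalerAr (mulrA x) xv -scalerAl scalerA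
                         mulrA [t * s]mulrC.
Qed.

Lemma qcommMr s t x v w : qcomm s x v -> qcomm t x w -> qcomm (s * t) x (v * w).
Proof.
by move=> xv xw; rewrite /qcomm (mulrA x) xv -scalerAl -(mulrA v x) xw -scalerAr
                         scalerA mulrA.
Qed.

Lemma qcommX s x v n : qcomm s x v -> qcomm (s ^+ n) (x ^+ n) v.
Proof.
move=> xv; elim: n => [|n IHn]; first exact: qcomm1.
by rewrite !exprS; apply: qcommMl.
Qed.

(** In the application [a] and [d] do not commute, but they do behind an odd [v]; this records the
    same weak commutation for other elements [w]. *)
Definition commutes_after a d v w :=
  v * w * a = v * a * w /\ v * w * d = v * d * w.

Lemma commutes_after_sym a d v w :
  commutes_after a d v w -> commutes_after d a v w.
Proof. by case. Qed.

Lemma commutes_after0 a d v : commutes_after a d v 0.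
Proof. by rewrite /commutes_after !mulr0 !mul0r. Qed.

Lemma commutes_after1 a d v : commutes_after a d v 1.
Proof. by rewrite /commutes_after !mulr1. Qed.

Lemma commutes_afterD a d v w w' : commutes_after a d v w ->
  commutes_after a d v w' -> commutes_after a d v (w + w').
Proof.
by move=> [wa wd] [wa' wd']; split; rewrite !mulrDr !mulrDl ?wa ?wd ?wa' ?wd'.
Qed.

Lemma commutes_afterZ a d v w k :
  commutes_after a d v w -> commutes_after a d v (k *: w).
Proof. by move=> [wa wd]; split; rewrite -!scalerAr -!scalerAl ?wa ?wd. Qed.

(** Moving [x] to the left of [v] costs only the factor [s], which cancels. So an equality known
    only behind [v] can be used deeper inside a product. *)
Lemma eq_mulr_after s x v w w' : s != 0 -> qcomm s x v ->
  v * w = v * w' -> v * x * w = v * x * w'.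
Proof.
move=> s0 xv eq_vw; apply: (scalerI s0).
by rewrite !(scalerAl s (v * x)) -xv -!mulrA eq_vw.
Qed.

Lemma commutes_afterX s a d v w n : s != 0 -> qcomm s a v ->
  commutes_after a d v w -> v * w * a ^+ n = v * a ^+ n * w.
Proof.
move=> s0 av [wa _]; elim: n => [|n IHn]; first by rewrite expr0 !mulr1.
rewrite exprS mulrA wa -mulrA (_ : v * a * _ = v * a * (a ^+ n * w)).
  by rewrite !mulrA.
by apply: (eq_mulr_after s0 av); rewrite !mulrA.
Qed.

Lemma commutes_afterM s a d v w : s != 0 -> qcomm s a v -> qcomm s d v ->
  v * a * d = v * d * a ->
  commutes_after a d v w -> commutes_after a d v (w * a).
Proof.
move=> s0 av dv vad [wa wd]; split; rewrite mulrA wa; first by rewrite -!mulrA.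
have -> : v * a * w * d = v * a * (d * w).
  by rewrite -mulrA; apply: (eq_mulr_after s0 av); rewrite !mulrA.
by rewrite mulrA vad -mulrA; apply: (eq_mulr_after s0 dv); rewrite !mulrA wa.
Qed.

End QuasiCommutation.

(** * Products of the odd elements *)

Section PowersInGL11.
(* [z] is a variable, not a local definition, so that [mulrA] does not unfold it. *)
Variables (K : fieldType) (A : algType K) (p q : K) (a beta gamma d z : A).
Hypotheses (p_neq0 : p != 0) (q_neq0 : q != 0).
Hypotheses (rel : GL11_relations p q a beta gamma d) (zE : z = gamma * beta).

Let a_beta : qcomm q a beta. Proof. exact: GL11_abeta rel. Qed.
Let d_beta : qcomm q d beta. Proof. exact: GL11_dbeta rel. Qed.
Let a_gamma : qcomm p a gamma. Proof. exact: GL11_agamma rel. Qed.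
Let d_gamma : qcomm p d gamma. Proof. exact: GL11_dgamma rel. Qed.
Let a_z : qcomm (p * q) a z. Proof. rewrite zE; exact: qcommMr. Qed.
Let d_z : qcomm (p * q) d z. Proof. rewrite zE; exact: qcommMr. Qed.
Let pq_neq0 : p * q != 0. Proof. by rewrite mulf_neq0. Qed.

Let beta_gamma : beta * gamma = - (p / q) *: z.
Proof. by rewrite zE scaleNr; apply/eqP; rewrite -addr_eq0 (GL11_betagamma rel). Qed.

Let beta_beta : beta * beta = 0. Proof. exact: GL11_beta2 rel. Qed.
Let gamma_gamma : gamma * gamma = 0. Proof. exact: GL11_gamma2 rel. Qed.

Let z_beta : z * beta = 0.
Proof. by rewrite zE -mulrA beta_beta mulr0. Qed.

Let gamma_z : gamma * z = 0.
Proof. by rewrite zE mulrA gamma_gamma mul0r. Qed.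

Let z_gamma : z * gamma = 0.
Proof. by rewrite {1}zE -mulrA beta_gamma -scalerAr gamma_z scaler0. Qed.

Let beta_z : beta * z = 0.
Proof. by rewrite zE mulrA beta_gamma -scalerAl z_beta scaler0. Qed.

(** The commutator of [a] and [d] is a multiple of [z], and [beta * z = 0]. *)
Let beta_ad : beta * a * d = beta * d * a.
Proof.
apply/eqP; rewrite -subr_eq0 -!mulrA -mulrBr (GL11_ad rel) -scalerAr.
by rewrite -zE beta_z scaler0.
Qed.

Let gamma_ad : gamma * a * d = gamma * d * a.
Proof.
apply/eqP; rewrite -subr_eq0 -!mulrA -mulrBr (GL11_ad rel) -scalerAr.
by rewrite -zE gamma_z scaler0.
Qed.

Let z_ad : z * a * d = z * d * a.
Proof.
by rewrite zE -!mulrA; congr (_ * _); rewrite !mulrA.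
Qed.

(** * Tame and normal elements *)

(** These properties are what is asked of the factors [x] and [y] in the diagonal entries, which
    stand behind a multiple of [z]. *)
Definition tame w :=
  [/\ commutes_after a d z w, z * w * beta = 0 & z * w * gamma = 0].

Lemma tame0 : tame 0.
Proof. by split; [exact: commutes_after0 | |]; rewrite mulr0 mul0r. Qed.

Lemma tameD w w' : tame w -> tame w' -> tame (w + w').
Proof.
case=> ? wb wg [? w'b w'g]; split; first exact: commutes_afterD.
  by rewrite mulrDr mulrDl wb w'b addr0.
by rewrite mulrDr mulrDl wg w'g addr0.
Qed.

Lemma tameZ k w : tame w -> tame (k *: w).
Proof.
case=> ? wb wg; split; first exact: commutes_afterZ.
  by rewrite -scalerAr -scalerAl wb scaler0.
by rewrite -scalerAr -scalerAl wg scaler0.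
Qed.

Lemma tame_mula w : tame w -> tame (w * a).
Proof.
case=> ? wb wg; split; first exact: (commutes_afterM pq_neq0).
  by rewrite mulrA -mulrA a_beta -scalerAr mulrA wb mul0r scaler0.
by rewrite mulrA -mulrA a_gamma -scalerAr mulrA wg mul0r scaler0.
Qed.

Lemma tame_muld w : tame w -> tame (w * d).
Proof.
case=> /commutes_after_sym ? wb wg; split.
- exact/commutes_after_sym/(commutes_afterM pq_neq0).
- by rewrite mulrA -mulrA d_beta -scalerAr mulrA wb mul0r scaler0.
- by rewrite mulrA -mulrA d_gamma -scalerAr mulrA wg mul0r scaler0.
Qed.

(* These are the properties of a homogeneous polynomial of degree n in a and d. *)
Definition normal n w :=
  [/\ qcomm (q ^+ n) w beta, qcomm (p ^+ n) w gamma,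
      commutes_after a d beta w, commutes_after a d gamma w &
      forall w', tame w' -> z * w' * w = z * w * w'].

Lemma normal1 : normal 0 1.
Proof.
split; try exact: qcomm1; try exact: commutes_after1.
by move=> w _; rewrite !mulr1.
Qed.

Lemma normalD n w w' : normal n w -> normal n w' -> normal n (w + w').
Proof.
case=> ? ? ? ? zw [? ? ? ? zw']; split; try exact: qcommD.
- exact: commutes_afterD.
- exact: commutes_afterD.
by move=> v tv; rewrite !mulrDr mulrDl zw ?zw'.
Qed.

Lemma normalZ n k w : normal n w -> normal n (k *: w).
Proof.
case=> ? ? ? ? zw; split; try exact: qcommZ; try exact: commutes_afterZ.
by move=> v tv; rewrite -!scalerAr -scalerAl zw.
Qed.

Lemma normal_z n w : normal n w -> qcomm ((p * q) ^+ n) w z.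
Proof. by case=> *; rewrite zE exprMn; apply: qcommMr. Qed.

Lemma normal_mula n w : normal n w -> normal n.+1 (w * a).
Proof.
move=> nw; have [wb wg cb cg zw] := nw.
split; rewrite ?exprSr; try exact: qcommMl.
- exact: (commutes_afterM q_neq0).
- exact: (commutes_afterM p_neq0).
move=> v tv; rewrite !mulrA zw // -[RHS]mulrA -mulrA.
(* It remains to swap [v] and [a] behind [z * w]; since [w] quasi-commutes with [z], swapping them
   behind [z] is enough. *)
apply: (eq_mulr_after (expf_neq0 n pq_neq0) (normal_z nw)).
by rewrite !mulrA; case: tv => - [].
Qed.

Lemma normal_muld n w : normal n w -> normal n.+1 (w * d).
Proof.
move=> nw; have [wb wg /commutes_after_sym cb /commutes_after_sym cg zw] := nw.
split; rewrite ?exprSr; try exact: qcommMl.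
- exact/commutes_after_sym/(commutes_afterM q_neq0).
- exact/commutes_after_sym/(commutes_afterM p_neq0).
move=> v tv; rewrite !mulrA zw // -[RHS]mulrA -mulrA.
apply: (eq_mulr_after (expf_neq0 n pq_neq0) (normal_z nw)).
by rewrite !mulrA; case: tv => - [].
Qed.

Lemma normal_expa n : normal n (a ^+ n).
Proof.
elim: n => [|n IHn]; first exact: normal1.
by rewrite exprSr; apply: normal_mula.
Qed.

Lemma normal_expd n : normal n (d ^+ n).
Proof.
elim: n => [|n IHn]; first exact: normal1.
by rewrite exprSr; apply: normal_muld.
Qed.

(** As [z] ends in [beta], commutation behind [beta] gives commutation behind [z]. An odd factor on
    the right moves through [w] and is annihilated by [z]. *)
Lemma normal_tame n w : normal n w -> tame w.
Proof.
case=> wb wg [ba bd] _ _; split.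
- by split; rewrite zE -!mulrA; congr (_ * _); rewrite !mulrA.
- by rewrite -mulrA wb -scalerAr mulrA z_beta mul0r scaler0.
- by rewrite -mulrA wg -scalerAr mulrA z_gamma mul0r scaler0.
Qed.

Lemma tame_expa w n : tame w -> z * w * a ^+ n = z * a ^+ n * w.
Proof. by case: (normal_expa n) => _ _ _ _; apply. Qed.

Lemma tame_expd w n : tame w -> z * w * d ^+ n = z * d ^+ n * w.
Proof. by case: (normal_expd n) => _ _ _ _; apply. Qed.

(** * The integers [n]_r for r = p q, and commutators of powers of [a] and [d] *)

Let qint n : K := \sum_(i < n) (p * q) ^+ i.

Let qintS n : qint n.+1 = qint n + (p * q) ^+ n.
Proof. by rewrite /qint big_ord_recr. Qed.

Let qintSl n : qint n.+1 = 1 + p * q * qint n.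
Proof.
rewrite /qint big_ord_recl expr0 mulr_sumr; congr (_ + _).
by apply: eq_bigr => i _; rewrite lift0 exprS.
Qed.

(** Each passage of [a] through a factor [d] emits a multiple of [z]; bringing it to the front
    through i factors [d] costs r^i, and these costs add up to [n+1]_r. *)
Lemma commutator_a_expd n : a * d ^+ n.+1 - d ^+ n.+1 * a =
  ((p - q^-1) * qint n.+1) *: (z * d ^+ n).
Proof.
have ad : a * d = d * a + (p - q^-1) *: z.
  by apply/eqP; rewrite addrC -subr_eq (GL11_ad rel) zE.
apply/eqP; rewrite subr_eq addrC; apply/eqP.
elim: n => [|n IHn].
  by rewrite /qint big_ord1 !expr0 !expr1 !mulr1 ad.
rewrite exprSr mulrA IHn mulrDl -mulrA ad mulrDr -scalerAr.
rewrite (qcommX n.+1 d_z) -scalerAl -[z * _ * d]mulrA -exprSr !scalerA.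
by rewrite mulrA -addrA -scalerDl (qintS n.+1) mulrDr [_ + _ * qint _]addrC.
Qed.

(** Induction on [m]: a further [a] on the left contributes the previous commutator once, and
    multiplies the old term by r as it passes [z]. The coefficients combine by [m+2]_r = 1 + r
    [m+1]_r. *)
Lemma commutator_expa_expd m n : a ^+ m.+1 * d ^+ n.+1 - d ^+ n.+1 * a ^+ m.+1 =
  ((p - q^-1) * qint m.+1 * qint n.+1) *: (z * a ^+ m * d ^+ n).
Proof.
have ad := commutator_a_expd n.
have {}ad : a * d ^+ n.+1 = d ^+ n.+1 * a +
    ((p - q^-1) * qint n.+1) *: (z * d ^+ n) by rewrite -ad addrC subrK.
apply/eqP; rewrite subr_eq addrC; apply/eqP.
elim: m => [|m IHm].
  by rewrite {1}/qint big_ord1 !expr0 !expr1 !mulr1 ad.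
have zda : z * d ^+ n * a ^+ m.+1 = z * a ^+ m.+1 * d ^+ n.
  exact/tame_expa/normal_tame/normal_expd.
rewrite exprS -mulrA IHm mulrDr (mulrA a) ad mulrDl -scalerAl zda.
rewrite -(mulrA _ a) -addrA; congr (_ + _); rewrite -scalerAr !mulrA a_z.
rewrite -!scalerAl -[z * a * _]mulrA -exprS scalerA -scalerDl; congr (_ *: _).
rewrite (qintSl m.+1); ring.
Qed.

(** * The explicit form of the powers of T *)

(** Index [m] describes the power m + 1, so that [b] and [c] have degree [m]. The identity [pf_cb]
    is carried along for the commutator of the diagonal entries. *)
Record power_form m (M : 'M[A]_2) b c x y : Prop := PowerForm {
  pf_A : M 0 0 = a ^+ m.+1 + beta * gamma * x;
  pf_B : M 0 1 = beta * b;
  pf_C : M 1 0 = gamma * c;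
  pf_D : M 1 1 = d ^+ m.+1 + gamma * beta * y;
  pf_b : normal m b;
  pf_c : normal m c;
  pf_x : tame x;
  pf_y : tame y;
  pf_cb : z * c * b = qint m.+1 *: (z * a ^+ m * d ^+ m) +
     q *: (z * a ^+ m.+1 * y) + p *: (z * d ^+ m.+1 * x)
}.

Lemma power_form1 (T : 'M[A]_2) : T 0 0 = a -> T 0 1 = beta ->
  T 1 0 = gamma -> T 1 1 = d -> power_form 0 T 1 1 0 0.
Proof.
move=> T00 T01 T10 T11.
have [tame_0 norm1] := (tame0, normal1).
split; rewrite ?mulr0 ?mulr1 ?addr0 ?expr1 //.
by rewrite !scaler0 !addr0 /qint big_ord1 expr0 scale1r.
Qed.

(** The new [b], [c], [x], [y] are read off from [M * T] by moving odd factors to the left; terms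
    with three odd factors vanish. *)
Lemma power_formS m (M T : 'M[A]_2) b c x y : T 0 0 = a -> T 0 1 = beta ->
  T 1 0 = gamma -> T 1 1 = d -> power_form m M b c x y ->
  power_form m.+1 (M * T) (q ^+ m.+1 *: a ^+ m.+1 + b * d)
    (c * a + p ^+ m.+1 *: d ^+ m.+1) (x * a + p ^+ m *: b) (y * d + q ^+ m *: c).
Proof.
move=> T00 T01 T10 T11 [MA MB MC MD nb nc tx ty cb].
have [[b_beta b_gamma _ _ _] [c_beta c_gamma _ _ _]] := (nb, nc).
have [tb tc] := (normal_tame nb, normal_tame nc).
have [[zx x_beta x_gamma] [zy y_beta y_gamma]] := (tx, ty).
split; rewrite ?mxE2 ?T00 ?T01 ?T10 ?T11 ?MA ?MB ?MC ?MD.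
- rewrite mulrDl -exprSr -addrA; congr (_ + _).
  by rewrite mulrDr -!mulrA b_gamma -!scalerAr.
- rewrite mulrDl beta_gamma -!scalerAl x_beta scaler0 addr0.
  by rewrite (qcommX m.+1 a_beta) mulrDr -scalerAr mulrA.
- rewrite mulrDl -zE y_gamma addr0 (qcommX m.+1 d_gamma) mulrDr -scalerAr.
  by rewrite mulrA.
- rewrite mulrDl addrCA -exprSr; congr (_ + _).
  by rewrite addrC mulrDr -!mulrA c_beta -!scalerAr.
- apply: normalD; last exact: normal_muld.
  exact/normalZ/normal_expa.
- apply: normalD; first exact: normal_mula.
  exact/normalZ/normal_expd.
- by apply: tameD; [exact: tame_mula | exact: tameZ].
- by apply: tameD; [exact: tame_muld | exact: tameZ].
(* The new [c * b] expands into four terms behind [z]. Those with a single old [c] or [b] match the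
   new parts of [y] and [x], the term in [d] and [a] alone raises [m+1]_r to [m+2]_r, and
   [c * a * (b * d)] reduces to the induction hypothesis. *)
have tY n := normal_tame (normal_expd n).
have r_neq0 : (p * q) ^+ m.+1 != 0 by rewrite expf_neq0.
have zd_z := qcommX m.+1 d_z.
have zca : z * c * a = z * a * c by case: tc => - [].
have c_term : z * c * a * a ^+ m.+1 = z * a ^+ m.+2 * c.
  by rewrite -mulrA -exprS tame_expa.
have b_term : z * d ^+ m.+1 * (b * d) = z * d ^+ m.+2 * b.
  have -> : z * d ^+ m.+1 * (b * d) = z * d ^+ m.+1 * (d * b).
    by apply: (eq_mulr_after r_neq0 zd_z); rewrite !mulrA; case: tb => - [].
  by rewrite (exprSr d m.+1) !mulrA.
have x_term : z * a * (d ^+ m.+1 * x * d) = z * d ^+ m.+2 * (x * a).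
  have e : z * a * d ^+ m.+1 = z * d ^+ m.+1 * a by case: (tY m.+1) => - [].
  rewrite -(mulrA (d ^+ _)) (mulrA (z * a)) e -(mulrA _ a).
  have -> : z * d ^+ m.+1 * (a * (x * d)) = z * d ^+ m.+1 * (d * (x * a)).
    apply: (eq_mulr_after r_neq0 zd_z); rewrite !mulrA -(proj1 zx).
    by case: (tame_mula tx) => - [_]; rewrite !mulrA.
  by rewrite (exprSr d m.+1) !mulrA.
have cb_term : z * c * a * (b * d) = qint m.+1 *: (z * a ^+ m.+1 * d ^+ m.+1) +
     q *: (z * a ^+ m.+2 * (y * d)) + p *: (z * d ^+ m.+2 * (x * a)).
  (* The hypothesis on [c * b] holds only behind [z]; it is applied here behind [z * a]. *)
  rewrite zca -x_term mulrA -(mulrA _ c) (@eq_mulr_after _ _ _ _ _ _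
    (qint m.+1 *: (a ^+ m * d ^+ m) + q *: (a ^+ m.+1 * y) +
     p *: (d ^+ m.+1 * x)) pq_neq0 a_z); last first.
    by rewrite mulrA cb !mulrDr -!scalerAr !mulrA.
  rewrite !mulrDr !mulrDl -!scalerAr -!scalerAl.
  by rewrite (exprS a m.+1) (exprS a m) (exprSr d m) !mulrA.
have da_term : z * d ^+ m.+1 * a ^+ m.+1 = z * a ^+ m.+1 * d ^+ m.+1.
  exact: tame_expa.
rewrite (mulrDr z) mulrDr !mulrDl -!scalerAr -!scalerAl !(mulrA z c).
rewrite c_term cb_term da_term b_term.
rewrite (qintS m.+1) scalerDl !mulrDr !scalerDr -!scalerAr !scalerA -!exprS.
rewrite -exprMn [q * p]mulrC !addrA.
by rewrite [LHS](ACl (3 * 2 * 4 * 1 * 5 * 6)).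
Qed.
Lemma power_form_GL11 m M b c x y : power_form m M b c x y ->
  in_GL11 (p ^+ m.+1) (q ^+ m.+1) M.
Proof.
move=> [MA MB MC MD nb nc tx ty cb].
have [[b_beta b_gamma bb _ _] [c_beta c_gamma _ cg zc]] := (nb, nc).
have [[zx x_beta x_gamma] [zy y_beta y_gamma]] := (tx, ty).
have bXa n : beta * b * a ^+ n = beta * a ^+ n * b.
  exact: (commutes_afterX n q_neq0 a_beta bb).
have bXd n : beta * b * d ^+ n = beta * d ^+ n * b.
  exact: (commutes_afterX n q_neq0 d_beta (commutes_after_sym bb)).
have cXa n : gamma * c * a ^+ n = gamma * a ^+ n * c.
  exact: (commutes_afterX n p_neq0 a_gamma cg).
have cXd n : gamma * c * d ^+ n = gamma * d ^+ n * c.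
  exact: (commutes_afterX n p_neq0 d_gamma (commutes_after_sym cg)).
have b_z : beta * b * z = 0.
  by rewrite zE mulrA -(mulrA beta) b_gamma -scalerAr -scalerAl -!mulrA b_beta
    -!scalerAr !mulrA -(mulrA beta) -zE beta_z mul0r !scaler0.
have c_z : gamma * c * z = 0.
  by rewrite zE mulrA -(mulrA gamma) c_gamma -scalerAr -scalerAl mulrA
    gamma_gamma !mul0r scaler0.
(* Both products of off-diagonal entries are multiples of the same [z * c * b], because [b] and [c]
   commute behind [z]. *)
have BC : beta * b * (gamma * c) = - (p ^+ m.+1 / q) *: (z * c * b).
  rewrite mulrA -(mulrA beta) b_gamma -scalerAr -scalerAl mulrA beta_gamma.
  rewrite -!scalerAl (zc b) ?scalerA; last exact: normal_tame nb.
  congr (_ *: _).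
  by rewrite exprSr; field.
have CB : gamma * c * (beta * b) = q ^+ m *: (z * c * b).
  by rewrite mulrA -(mulrA gamma) c_beta -scalerAr -scalerAl mulrA -zE.
rewrite /in_GL11 MA MB MC MD beta_gamma -zE -scalerAl.
split.
- rewrite mulrDl -scalerAl (mulrA (z * x)) x_beta mul0r scaler0 addr0.
  rewrite mulrA (qcommX _ a_beta) -scalerAl -bXa mulrDr.
  by rewrite -scalerAr (mulrA _ z) b_z mul0r scaler0 addr0.
- rewrite mulrDl (mulrA (z * y)) y_beta mul0r addr0.
  rewrite mulrA (qcommX _ d_beta) -scalerAl -bXd mulrDr.
  by rewrite (mulrA _ z) b_z mul0r addr0.
- rewrite mulrDl -scalerAl (mulrA (z * x)) x_gamma mul0r scaler0 addr0.
  rewrite mulrA (qcommX _ a_gamma) -scalerAl -cXa mulrDr.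
  by rewrite -scalerAr (mulrA _ z) c_z mul0r scaler0 addr0.
- rewrite mulrDl (mulrA (z * y)) y_gamma mul0r addr0.
  rewrite mulrA (qcommX _ d_gamma) -scalerAl -cXd mulrDr.
  by rewrite (mulrA _ z) c_z mul0r addr0.
- rewrite BC CB scalerA -scalerDl (_ : _ + _ = 0) ?scale0r //.
  by rewrite (exprS q); field; rewrite q_neq0 expf_neq0.
- by rewrite expr2 mulrA -(mulrA beta) b_beta -scalerAr -scalerAl mulrA beta_beta
    !mul0r scaler0.
- by rewrite expr2 mulrA -(mulrA gamma) c_gamma -scalerAr -scalerAl mulrA
    gamma_gamma !mul0r scaler0.
rewrite CB cb.
(* The product of the two diagonal corrections vanishes, so both orders of the diagonal product stay
   linear in [x] and [y]. *)
have zz w w' : tame w -> z * w * (z * w') = 0.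
  by case=> _ _ wg; rewrite mulrA {2}zE (mulrA _ gamma) wg !mul0r.
have AD : (a ^+ m.+1 - (p / q) *: (z * x)) * (d ^+ m.+1 + z * y) =
    a ^+ m.+1 * d ^+ m.+1 + (p * q) ^+ m.+1 *: (z * a ^+ m.+1 * y)
    - (p / q) *: (z * d ^+ m.+1 * x).
  rewrite mulrDl !mulrDr !mulNr -!scalerAl zz // tame_expd // scaler0 subr0.
  by rewrite (mulrA (a ^+ _)) (qcommX _ a_z) -scalerAl.
have DA : (d ^+ m.+1 + z * y) * (a ^+ m.+1 - (p / q) *: (z * x)) =
    d ^+ m.+1 * a ^+ m.+1 + z * a ^+ m.+1 * y
    - (p / q * (p * q) ^+ m.+1) *: (z * d ^+ m.+1 * x).
  rewrite mulrDr mulrN -scalerAr !mulrDl zz // addr0 tame_expa //.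
  by rewrite (mulrA (d ^+ _)) (qcommX _ d_z) -scalerAl scalerA.
rewrite scaleNr AD DA -[a ^+ _ * _](subrK (d ^+ m.+1 * a ^+ m.+1)).
rewrite commutator_expa_expd.
have r_geom : (p * q - 1) * qint m.+1 = p ^+ m.+1 * q ^+ m.+1 - 1.
  by rewrite -exprMn subrX1.
have qn_neq0 : q ^+ m != 0 by rewrite expf_neq0.
(* With N = m + 1, [c0], [c1] and [c2] match the coefficients of [z * a ^+ m * d ^+ m],
   [z * a ^+ N * y] and [z * d ^+ N * x]. All rest on (p^N - q^-N) q^N = r^N - 1, and [c0] also on
   r^N - 1 = (r - 1) [N]_r. *)
have c0 : (p ^+ m.+1 - (q ^+ m.+1)^-1) * q ^+ m * qint m.+1 =
    (p - q^-1) * qint m.+1 * qint m.+1.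
  congr (_ * _); apply: (mulfI q_neq0).
  rewrite [RHS]mulrA mulrBr mulfV // [q * p]mulrC r_geom !exprS; field.
  by rewrite ?q_neq0 ?qn_neq0.
have c1 : (p ^+ m.+1 - (q ^+ m.+1)^-1) * q ^+ m * q = (p * q) ^+ m.+1 - 1.
  by rewrite exprMn !exprS; field; rewrite ?q_neq0 ?qn_neq0.
have c2 : (p ^+ m.+1 - (q ^+ m.+1)^-1) * q ^+ m * p =
    p / q * (p * q) ^+ m.+1 - p / q.
  by rewrite exprMn !exprS; field; rewrite ?q_neq0 ?qn_neq0.
rewrite scalerA !scalerDr !scalerA c0 c1 c2 !scalerBl scale1r !opprD opprK !addrA.
rewrite [LHS](ACl (1 * 3 * 6 * 7 * 4 * 2 * 5)); exact: addrK.
Qed.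

End PowersInGL11.

Lemma GL11_expr (K : fieldType) (A : algType K) (p q : K) (T : 'M[A]_2) n :
  p != 0 -> q != 0 -> in_GL11 p q T -> in_GL11 (p ^+ n.+1) (q ^+ n.+1) (T ^+ n.+1).
Proof.
move=> p0 q0 rel; have zE := erefl (T 1 0 * T 0 1).
suff [b [c [x [y Tn]]]] : exists b c x y,
    power_form p q (T 0 0) (T 0 1) (T 1 0) (T 1 1) (T 1 0 * T 0 1) n
      (T ^+ n.+1) b c x y by exact: (power_form_GL11 p0 q0 rel zE Tn).
elim: n => [|n [b [c [x [y IHn]]]]].
  by exists 1, 1, 0, 0; apply: power_form1.
rewrite exprSr.
(* Unification takes the four witnesses from the recurrences of [power_formS]. *)
by do 4!eexists; apply: (power_formS p0 q0 rel zE) IHn.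
Qed.

Theorem lemma3p2 (R : realType) (A : algType R[i]) (p q : R[i])
    (hp : p != 0) (hq : q != 0) (hpq1 : p * q != 1) (hpqN1 : p * q != -1)
    (T : 'M[A]_2) (hT : in_GL11 p q T)
    (ha : invertible (T 0 0)) (hd : invertible (T 1 1))
    (n : nat) (hn : (0 < n)%N) :
  in_GL11 (p ^+ n) (q ^+ n) (T ^+ n) /\
  (let An := (T ^+ n) 0 0 in
   let Bn := (T ^+ n) 0 1 in
   let Cn := (T ^+ n) 1 0 in
   let Dn := (T ^+ n) 1 1 in
   (An * Bn = q ^+ n *: (Bn * An) /\ Dn * Bn = q ^+ n *: (Bn * Dn)) /\
   (An * Cn = p ^+ n *: (Cn * An) /\ Dn * Cn = p ^+ n *: (Cn * Dn)) /\
   (Bn ^+ 2 = 0 /\ Cn ^+ 2 = 0) /\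
   q ^+ n *: (Bn * Cn) + p ^+ n *: (Cn * Bn) = 0 /\
   An * Dn - Dn * An = (p ^+ n - q ^- n) *: (Cn * Bn)).
Proof.
case: n hn => // n _; have Tn := GL11_expr n hp hq hT.
split=> //; case: Tn => AB DB AC DC BC BB CC AD /=.
do ![split=> //].
(* The symmetric relation is q^n times the one in [GL11_relations], so a factor q^n is pulled
   out. *)
rewrite -[X in _ + X](scalerKV (expf_neq0 n.+1 hq)) -scalerDr scalerA mulrC.
by rewrite BC scaler0.
Qed.
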